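(* Let $N$ be a positive integer with base-$\varphi$ representation $N=\sum_{k=R}^{L} d_k\varphi^k$, where $\varphi=\frac{1+\sqrt5}{2}$, $R\le 0\le L$ are integers, each $d_k\in\{0,1\}$, and $d_kd_{k+1}=0$ for all $k$. Suppose there is a positive index $j$ with $d_j=1$, and let $i$ be the smallest positive index with $d_i=1$ (so $d_j=0$ for $0<j<i$). Then \[N = d_L L_L + d_{L-1}L_{L-1}+\dots+d_1L_1+d_0+1 \quad\text{if } i \text{ is odd},\] \[N = d_L L_L + d_{L-1}L_{L-1}+\dots+d_1L_1+d_0 \quad\text{if } i \text{ is even},\] where $L_n$ denotes the $n$-th Lucas number.
   Context: The Lucas numbers are defined by $L_0=2$, $L_1=1$, $L_n=L_{n-1}+L_{n-2}$. A base-$\varphi$ representation of $N$ is an expression $N=\sum_{k=R}^{L}d_k\varphi^k$ with digits $d_k\in\{0,1\}$, no two consecutive digits equal to $1$, and $R\le 0\le L$; every positive integer has a unique such representation (up to leading/trailing zeros). *)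

(* Defs.v *)
From mathcomp Require Import all_boot all_order all_algebra.
From mathcomp Require Import reals.

Set Implicit Arguments.
Unset Strict Implicit.
Unset Printing Implicit Defensive.

Import Order.TTheory GRing.Theory Num.Theory.

Local Open Scope ring_scope.

Fixpoint lucas (n : nat) : nat :=
  match n with
  | 0 => 2
  | 1 => 1
  | (m.+1 as n').+1 => lucas n' + lucas m
  end%N.

Definition phi (R : realType) : R := (1 + Num.sqrt 5) / 2.

(* The indices range over the integer interval [r, l], enumerated as r + t   *)
(* for 0 <= t < l - r + 1; the values of d outside of it are irrelevant.     *)
(* Leading and trailing zeros are allowed.                                   *)
Definition base_phi_rep (R : realType) (N : nat) (r l : int) (d : int -> nat)
    : Prop :=
  [/\ r <= 0 <= l,
      forall k : int, r <= k <= l -> d k \in [:: 0%N; 1%N],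
      forall k : int, r <= k < l -> (d k * d (k + 1)%R)%N = 0%N
    & N%:R = \sum_(0 <= t < `|l - r|%N.+1)
                (d (r + t%:Z))%:R * phi R ^ (r + t%:Z)].

Definition least_positive_one (l : int) (d : int -> nat) (i : nat) : Prop :=
  [/\ 0 < i%:Z <= l,
      d i%:Z = 1%N
    & forall j : nat, 0 < j%:Z <= l -> d j%:Z = 1%N -> (i <= j)%N].

(* Main.v *)
(** Since [L_k = phi^k + (-1/phi)^k], the integer
    [N - (\sum_(k >= 1) d_k L_k + d_0)] equals [A - B] with
    [A = \sum_(k < 0) d_k phi^k] and [B = \sum_(k >= 1) d_k (-1/phi)^k].  Absence of consecutive ones gives
    [0 <= A < 1] and [|B| < 1], and [B] has the sign of its leading term
    [(-1/phi)^i].  Hence [A - B] lies in (-1, 1) if [i] is even and in (0, 2)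
    if [i] is odd, so it is 0, respectively 1. *)
Require Import Defs.
From mathcomp Require Import all_boot all_order all_algebra.
From mathcomp Require Import reals.
From mathcomp Require Import ring lra zify.

Set Implicit Arguments.
Unset Strict Implicit.
Unset Printing Implicit Defensive.

Import Order.TTheory GRing.Theory Num.Theory.

Local Open Scope ring_scope.

(** Common form of the two digit tails, each read from its heaviest digit onward, so that an
    induction peeling the head serves both. *)
Definition golden_digits (n : nat) (a : nat -> nat) : Prop :=
  (forall m, (m < n)%N -> a m \in [:: 0%N; 1%N]) /\
  (forall m, (m.+1 < n)%N -> (a m * a m.+1)%N = 0%N).

Lemma golden_digits_behead n a :
  golden_digits n.+1 a -> golden_digits n (fun m => a m.+1).
Proof. by case=> a01 aa; split=> m ltmn; [apply: a01 | apply: aa]. Qed.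

Lemma golden_digits_head n a : golden_digits n.+1 a ->
  a 0%N = 0%N \/ a 0%N = 1%N /\ ((0 < n)%N -> a 1%N = 0%N).
Proof.
case=> a01 aa; have := a01 0%N isT; rewrite !inE => /orP[] /eqP a0.
  by left.
by right; split=> // n_gt0; have := aa 0%N n_gt0; rewrite a0 mul1n.
Qed.

Lemma digit_sum_recl (R : realFieldType) (y : R) n (a : nat -> nat) :
  \sum_(m < n.+1) (a m)%:R * y ^+ m =
  (a 0%N)%:R + y * \sum_(m < n) (a m.+1)%:R * y ^+ m.
Proof.
rewrite big_ord_recl mulr1; congr (_ + _); rewrite mulr_sumr.
by apply: eq_bigr => m _; rewrite exprS mulrCA.
Qed.

(** Here x = 1/phi, so x(1 + x) = 1. With T' the sum for the remaining digits, a leading 0 gives T =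
    xT' < x(1 + x) = 1. A leading 1 forces the next digit to be 0, so T' < 1 and T = 1 + xT' < 1 +
    x. Each bound feeds the other, hence the joint induction. *)
Lemma digit_sum_bound (R : realFieldType) (x : R) n a :
  0 < x -> x ^+ 2 = 1 - x -> golden_digits n a ->
  let T := \sum_(m < n) (a m)%:R * x ^+ m in
  T < 1 + x /\ ((0 < n)%N -> a 0%N = 0%N -> T < 1).
Proof.
move=> x_gt0 x2; elim: n a => [|n IHn] a da /=.
  by rewrite big_ord0; split=> *; lra.
have [ltT ltT0] := IHn _ (golden_digits_behead da).
rewrite digit_sum_recl; set T := \sum_(m < n) _ in ltT ltT0 *.
have [a0|[a0 a1]] := golden_digits_head da.
  have xT : x * T < x * (1 + x) by rewrite ltr_pM2l.
  by rewrite a0; split=> *; nra.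
rewrite a0; split=> //.
have {ltT0} T1 : T < 1.
  case: (posnP n) => [n0|n_gt0]; last by apply: ltT0 => //; apply: a1.
  by rewrite /T n0 big_ord0.
by rewrite ltrD2l gtr_pMr.
Qed.

(** Now U = a_0 - xU'. A leading 0 turns -1 < U' < 1 + x into -1 < U < x. A leading 1 is followed by
    0, so -1 < U' < x and 1 - x^2 < U < 1 + x, where 1 - x^2 = x > 0. *)
Lemma alternating_digit_sum_bound (R : realFieldType) (x : R) n a :
  0 < x -> x ^+ 2 = 1 - x -> golden_digits n a ->
  let U := \sum_(m < n) (a m)%:R * (- x) ^+ m in
  [/\ -1 < U < 1 + x,
      (0 < n)%N -> a 0%N = 0%N -> U < x
    & (0 < n)%N -> a 0%N = 1%N -> 0 < U].
Proof.
move=> x_gt0 x2; elim: n a => [|n IHn] a da /=.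
  by rewrite big_ord0; split=> //; apply/andP; split; lra.
have [/andP[gtU ltU] ltU0 _] := IHn _ (golden_digits_behead da).
rewrite digit_sum_recl; set U := \sum_(m < n) _ in gtU ltU ltU0 *.
have [a0|[a0 a1]] := golden_digits_head da.
  have xU : x * U < x * (1 + x) by rewrite ltr_pM2l.
  have xU' : x * -1 < x * U by rewrite ltr_pM2l.
  by rewrite a0; split=> // *; try (apply/andP; split); nra.
have {ltU0} Ux : U < x.
  case: (posnP n) => [n0|n_gt0]; last by apply: ltU0 => //; apply: a1.
  by rewrite /U n0 big_ord0.
have xU : x * U < x * x by rewrite ltr_pM2l.
have xU' : x * -1 < x * U by rewrite ltr_pM2l.
by rewrite a0; split=> // *; try (apply/andP; split); nra.
Qed.

(** Both 1 + x and -x are roots of t^2 = t + 1, so their power sums satisfy the Lucas recurrence. *)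
Lemma lucas_Binet (R : realFieldType) (x : R) n : x ^+ 2 = 1 - x ->
  (lucas n)%:R = (1 + x) ^+ n + (- x) ^+ n.
Proof.
move=> x2; have phi2 : (1 + x) ^+ 2 = (1 + x) + 1 by rewrite sqrrD x2; ring.
have psi2 : (- x) ^+ 2 = - x + 1 by rewrite sqrrN x2; ring.
suff: (lucas n)%:R = (1 + x) ^+ n + (- x) ^+ n /\
      (lucas n.+1)%:R = (1 + x) ^+ n.+1 + (- x) ^+ n.+1 by case.
elim: n => [|n [IHn IHn1]]; first by rewrite !expr0 !expr1 /=; split; ring.
split=> //; rewrite [lucas _]/= -/(lucas n.+1) natrD IHn IHn1.
by rewrite -[n.+2]addn2 !exprD phi2 psi2 !exprS; ring.
Qed.

Lemma phi_inv_gt0_sqr (R : realType) :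
  let x := phi R - 1 in [/\ 0 < x, x ^+ 2 = 1 - x & (phi R)^-1 = x].
Proof.
set s := Num.sqrt (5 : R); have s2 : s ^+ 2 = 5 by rewrite sqr_sqrtr.
have s_ge0 : 0 <= s by apply: sqrtr_ge0.
have s_gt1 : 1 < s by nra.
rewrite /phi -/s /=; split; [lra|nra|].
have phi_neq0 : (1 + s) / 2 != 0 by apply: lt0r_neq0; lra.
apply: (mulfI phi_neq0); rewrite mulfV //; nra.
Qed.

Theorem theorem1 (R : realType) (N : nat) (r l : int) (d : int -> nat) (i : nat)
    (N_gt0 : (0 < N)%N)
    (repN : @base_phi_rep R N r l d)
    (leasti : least_positive_one l d i) :
  (odd i ->
     N = (\sum_(1 <= k < `|l|%N.+1) d (Posz k) * lucas k + d (Posz 0) + 1)%N)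
  /\ (~~ odd i ->
     N = (\sum_(1 <= k < `|l|%N.+1) d (Posz k) * lucas k + d (Posz 0))%N).
Proof.
case: repN => /andP[r_le0 l_ge0] d01 dd defN.
case: leasti => /andP[i_gt0 le_il] di1 min_i.
have [p def_r] : exists p : nat, r = - p%:Z by exists `|r|%N; lia.
have [q def_l] : exists q : nat, l = q%:Z by exists `|l|%N; lia.
subst r l; rewrite absz_nat.
have [x_gt0 x2 phiV] := phi_inv_gt0_sqr R.
set x := phi R - 1 in x_gt0 x2 phiV.
have def_phi : phi R = 1 + x by rewrite /x; ring.
pose S := (\sum_(1 <= k < q.+1) d (Posz k) * lucas k + d (Posz 0))%N.
rewrite -/S.
(* Negative positions are read downward from -1, so the fractional part of the representation is x *
   T. *)
pose T := \sum_(m < p) (d (- m.+1%:Z))%:R * x ^+ m.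
(* Reading starts at position [i], so the leading digit is 1 and [U] is positive. *)
pose U := \sum_(m < (q - i).+1) (d (i + m)%N%:Z)%:R * (- x) ^+ m.
have T_ge0 : 0 <= T.
  by apply: sumr_ge0 => m _; rewrite mulr_ge0 ?ler0n ?exprn_ge0 ?ltW.
have dT : golden_digits p (fun m => d (- m.+1%:Z)).
  split=> m ltmp; first by apply: d01; lia.
  have := dd (- m.+2%:Z); rewrite mulnC.
  have -> : - m.+2%:Z + 1 = - m.+1%:Z by lia.
  by apply; lia.
have dU : golden_digits (q - i).+1 (fun m => d (i + m)%N%:Z).
  split=> m ltmq; first by apply: d01; lia.
  have := dd (i + m)%N%:Z.
  have -> : (i + m)%N%:Z + 1 = (i + m.+1)%N%:Z by lia.
  by apply; lia.
have [ltT _] := digit_sum_bound x_gt0 x2 dT.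
have [/andP[_ ltU] _ U_gt0] := alternating_digit_sum_bound x_gt0 x2 dU.
rewrite -/T -/U addn0 in ltT ltU U_gt0; have {}U_gt0 := U_gt0 isT di1.
(* Digits at positions 1 to [i] - 1 vanish by minimality of [i]; the factor (-x)^i comes out of the
   rest. *)
have defB : \sum_(1 <= k < q.+1) (d k%:Z)%:R * (- x) ^+ k = (- x) ^+ i * U.
  rewrite (@big_cat_nat _ _ _ i) /=; [|lia|lia].
  rewrite big_nat_cond big1 ?add0r => [|k]; last first.
    rewrite andbT => /andP[k_gt0 lt_ki].
    have := d01 k%:Z; rewrite !inE => /(_ ltac:(lia))/orP[]/eqP dk.
      by rewrite dk mul0r.
    by have := min_i k ltac:(lia) dk; lia.
  rewrite -{1}[i]add0n big_addn subSn; last lia.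
  rewrite big_mkord mulr_sumr; apply: eq_bigr => m _.
  by rewrite addnC exprD mulrCA.
have defNS : N%:R - S%:R = x * T - (- x) ^+ i * U.
  have defA : \sum_(0 <= t < p) (d (- p%:Z + t%:Z))%:R * phi R ^ (- p%:Z + t%:Z)
              = x * T.
    rewrite big_nat_rev big_mkord mulr_sumr; apply: eq_bigr => m _.
    have -> : - p%:Z + (0 + p - m.+1)%N%:Z = - m.+1%:Z.
      by have := ltn_ord m; lia.
    by rewrite -exprz_inv phiV -exprnP exprS mulrCA.
  have defS : S%:R = \sum_(1 <= k < q.+1) (d k%:Z)%:R * (1 + x) ^+ k
                     + \sum_(1 <= k < q.+1) (d k%:Z)%:R * (- x) ^+ k
                     + (d 0)%:R.
    rewrite /S natrD natr_sum -big_split; congr (_ + _).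
    by apply: eq_bigr => k _; rewrite natrM (lucas_Binet k x2) mulrDr.
  (* Cutting at t = [p] separates the negative exponents; the exponent-0 term then cancels the [d 0]
     in [S]. *)
  rewrite defN; have -> : `|q%:Z - - p%:Z|%N.+1 = (p + q.+1)%N by lia.
  rewrite (@big_cat_nat _ _ _ p) ?leq_addr //= defA defS defB.
  rewrite -{1}[p]add0n big_addn addKn big_nat_recl // add0n addNr expr0z mulr1.
  rewrite (eq_bigr (fun k : nat => (d k.+1%:Z)%:R * (1 + x) ^+ k.+1)).
    by rewrite big_add1; ring.
  move=> k _; have -> : - p%:Z + (k.+1 + p)%N%:Z = k.+1%:Z by lia.
  by rewrite -exprnP def_phi.
have xT_ge0 : 0 <= x * T by rewrite mulr_ge0 // ltW.
have xT_lt1 : x * T < 1.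
  have : x * T < x * (1 + x) by rewrite ltr_pM2l.
  nra.
have xi_gt0 : 0 < x ^+ i by rewrite exprn_gt0.
have x_le1 : x <= 1 by nra.
have xi_le : x ^+ i <= x by rewrite ler_iXnr // ltW.
have V_gt0 : 0 < x ^+ i * U by rewrite mulr_gt0.
(* Since [i] is at least 1 and x is at most 1, x^i U <= xU < x(1 + x) = 1. *)
have V_lt1 : x ^+ i * U < 1.
  have : x ^+ i * U <= x * U by rewrite ler_pM2r.
  have : x * U < x * (1 + x) by rewrite ltr_pM2l.
  nra.
(* The parity of [i] fixes the sign: N - S is xT + x^i U, in (0, 2), for odd [i], and xT - x^i U, in
   (-1, 1), for even [i]. The strict bounds are then read over the naturals. *)
rewrite exprNn -signr_odd in defNS.
split=> [i_odd|/negbTE i_even].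
  rewrite i_odd expr1 in defNS.
  have : (S < N)%N by rewrite -(ltr_nat R); lra.
  have : (N < S + 2)%N by rewrite -(ltr_nat R) natrD; lra.
  by clear; lia.
rewrite i_even expr0 in defNS.
have : (S < N + 1)%N by rewrite -(ltr_nat R) natrD; lra.
have : (N < S + 1)%N by rewrite -(ltr_nat R) natrD; lra.
by clear; lia.
Qed.
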